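(* The coalitional Tijs value on $\mathcal{HE}^*$, i.e. the map $(\Gamma,P)\mapsto\mathcal{T}(N,c,P)$ where $(N,c,P)$ is the game with a coalitional structure associated to $(\Gamma,P)$, satisfies (PO), (PSSA), (PSSU), (CPEA) and (CPEU), and it is the unique solution on $\mathcal{HE}^*$ satisfying these five properties.
   Context: A generalized highway problem is a 4-tuple $\Gamma=(N,K,C,T)$ where $N$ is a finite set of agents, $K$ is a finite nonempty ordered set of sections, $C:K\to\mathbb{R}_+$ gives the cost of each section, and $T:N\to 2^K\setminus\{\emptyset\}$ gives the set of sections used by each agent, with $\bigcup_{i\in N}T(i)=K$. For $S\subseteq N$ put $T(S)=\bigcup_{i\in S}T(i)$, and for $K'\subseteq K$ put $C(K')=\sum_{t\in K'}C(t)$. The associated cost game is $(N,c)$ with $c(S)=C(T(S))$; it is concave. If $P=\{P_1,\dots,P_A\}$ is a partition of $N$ (into nonempty a priori unions), $(\Gamma,P)$ is a generalized highway problem with a coalitional structure and $(N,c,P)$ its associated game; put $M=\{1,\dots,A\}$. The quotient game is $(M,c_P)$ with $c_P(H)=c(\bigcup_{a\in H}P_a)$, $H\subseteq M$. $\mathcal{HE}^*$ is the set of all generalized highway problems with a coalitional structure (agent set and section set vary). A solution (value) $\sigma$ on $\mathcal{HE}^*$ assigns to each $(\Gamma,P)\in\mathcal{HE}^*$ a vector $(\sigma_i(\Gamma,P))_{i\in N}\in\mathbb{R}^N$; by convention $\sigma_j(\Gamma,P)=0$ for $j\notin N$. Restriction: for $\emptyset\neq K'\subseteq K$, $\Gamma|_{K'}=(N|_{K'},K',C|_{K'},T^{K'})$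 with $N|_{K'}=\{i\in N\mid T(i)\cap K'\neq\emptyset\}$, $T^{K'}(i)=T(i)\cap K'$ (and $K'$ with the induced order); $P|_{K'}=\{P_a\cap N|_{K'}\mid P_a\in P,\ T(P_a)\cap K'\neq\emptyset\}$. Exclusive/shared sections: $N_t=\{j\in N\mid t\in T(j)\}$, $K^e=\{t\in K\mid|N_t|=1\}$, $K^s=K\setminus K^e$, $T^e(i)=T(i)\cap K^e$, $T^s(i)=T(i)\cap K^s$, $T^e(S)=\bigcup_{i\in S}T^e(i)$, $c^s(i)=C(T^s(i))$. In the quotient game: $\mathscr{A}_t=\{a\in M\mid t\in T(P_a)\}$, $K_P^e=\{t\in K\mid|\mathscr{A}_t|=1\}$, $K_P^s=K\setminus K_P^e$, $T_P^e(M)=\bigcup_{a\in M}(T(P_a)\cap K_P^e)$, $c_P^s(a)=C(T(P_a)\cap K_P^s)$. Tijs value of a concave cost game $(N,c)$: $\tau_i(N,c)=m_i+\alpha(M_i-m_i)$, where $M_i=c(N)-c(N\setminus\{i\})$, $m_i=\min_{S\subseteq N,\,i\in S}\{c(S)-\sum_{j\in S\setminus\{i\}}M_j\}$, and $\alpha\in[0,1]$ is such that $\sum_{i\in N}\tau_i(N,c)=c(N)$. Coalitional Tijs value of $(N,c,P)$ with $(N,c)$ concave: for $i\in P_a$, $\mathcal{T}_i(N,c,P)=m_i+\alpha_a(M_i-m_i)$, where $M_i=c(N)-c(N\setminus\{i\})$, $m_i=\min_{S\in P(a),\,i\in S}\{c(S)-\sum_{j\in S\setminus\{i\}}M_j\}$,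 $P(a)=\{\bigcup_{l\in L}P_l\cup T'\mid L\subseteq M\setminus\{a\},\,T'\subseteq P_a\}$, and $\alpha_a\in[0,1]$ is such that $\sum_{i\in P_a}\mathcal{T}_i(N,c,P)=\tau_a(M,c_P)$. Properties of a solution $\sigma$ ($\mathbb{R}_+$ is the set of nonnegative reals): - (PO) For all $(\Gamma,P)\in\mathcal{HE}^*$, $\sum_{i\in N}\sigma_i(\Gamma,P)=C(K)$. - (PSSA) For all $(\Gamma,P)\in\mathcal{HE}^*$ and $a\in M$ with $T^e(P_a)=\emptyset$, there exists $\mathfrak{c}_a\in\mathbb{R}_+$ such that $\sigma_i(\Gamma,P)=\mathfrak{c}_a\cdot c^s(i)$ for all $i\in P_a$. - (PSSU) For all $(\Gamma,P)\in\mathcal{HE}^*$ with $T_P^e(M)=\emptyset$, there exists $\mathfrak{c}\in\mathbb{R}_+$ such that $\sum_{i\in P_a}\sigma_i(\Gamma,P)=\mathfrak{c}\cdot c_P^s(a)$ for all $a\in M$. - (CPEA) For all $(\Gamma,P),(\Gamma',P')\in\mathcal{HE}^*$ with $\Gamma=(N,K,C,T)$, $\Gamma'=(N',K',C',T')$: if $i\in N'$, $K'=K\cup\{t\}$ with $t\notin K$, $\Gamma=\Gamma'|_K$, $P=P'|_K$, and $\{j\in N'\mid t\in T'(j)\}=\{i\}$, then $\sigma_i(\Gamma',P')=\sigma_i(\Gamma,P)+C'(t)$ and $\sigma_j(\Gamma',P')=\sigma_j(\Gamma,P)$ for all $j\in N'\setminus\{i\}$. - (CPEU) For all $(\Gamma,P),(\Gamma',P')\in\mathcal{HE}^*$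 with $\Gamma=(N,K,C,T)$, $\Gamma'=(N',K',C',T')$: if $P_a\in P'$, $K'=K\cup\{t\}$ with $t\notin K$, $\Gamma=\Gamma'|_K$, $P=P'|_K$, and $\{P_b\in P'\mid t\in T'(P_b)\}=\{P_a\}$, then $\sum_{i\in P_a}\sigma_i(\Gamma',P')=\sum_{i\in P_a}\sigma_i(\Gamma,P)+C'(t)$ and $\sum_{i\in P_b}\sigma_i(\Gamma',P')=\sum_{i\in P_b}\sigma_i(\Gamma,P)$ for all $P_b\in P'\setminus\{P_a\}$. *)

(* Defs.v *)
From mathcomp Require Import all_boot all_order all_algebra finmap.
From mathcomp Require Import all_classical all_reals.

Set Implicit Arguments.
Unset Strict Implicit.
Unset Printing Implicit Defensive.

Import Order.TTheory GRing.Theory Num.Theory.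

Local Open Scope fset_scope.
Local Open Scope ring_scope.

Definition is_partition (X : choiceType) (P : {fset {fset X}}) (N : {fset X}) :
    bool :=
  [&& fset0 \notin P, trivIfset P & fcover P == N].

(** * Cost games *)

Section Games.
Variables (R : realType) (X : choiceType).
Implicit Types (N : {fset X}) (c : {fset X} -> R) (P : {fset {fset X}}).

Definition marg N c (i : X) : R := c N - c (N `\ i).

Definition excess N c (i : X) (S : {fset X}) : R :=
  c S - \sum_(j <- S `\ i) marg N c j.

(* The minimum of [excess N c i S] over the S in F containing i. The seed of the
   iterated minimum is the value at S = N, and N is itself a member of each
   family F used below. *)
Definition min_excess N c (F : {fset {fset X}}) (i : X) : R :=
  \big[Num.min/excess N c i N]_(S <- F | i \in S) excess N c i S.

Definition interp (m M a : R) : R := m + a * (M - m).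

Definition tijs_min N c (i : X) : R := min_excess N c (fpowerset N) i.

(* For a concave game such a coefficient exists, and the value it yields does
   not depend on which one is picked. *)
Definition tijs_coef N c : R :=
  xget 0 [set a : R | 0 <= a <= 1 /\
    \sum_(i <- N) interp (tijs_min N c i) (marg N c i) a = c N]%classic.

Definition tijs N c (i : X) : R :=
  interp (tijs_min N c i) (marg N c i) (tijs_coef N c).

End Games.

Section CoalitionalGames.
Variables (R : realType) (X : choiceType).
Implicit Types (N B : {fset X}) (c : {fset X} -> R) (P : {fset {fset X}}).

(* The players of the quotient game are the unions themselves, rather than their
   indices 1, ..., A. *)
Definition quotient_game c (H : {fset {fset X}}) : R := c (fcover H).

Definition compat_coalitions P B : {fset {fset X}} :=
  [fset fcover L `|` T' | L in fpowerset (P `\ B), T' in fpowerset B].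

Definition ctijs_min N c P B (i : X) : R :=
  min_excess N c (compat_coalitions P B) i.

Definition ctijs_coef N c P B : R :=
  xget 0 [set a : R | 0 <= a <= 1 /\
    \sum_(i <- B) interp (ctijs_min N c P B i) (marg N c i) a
      = tijs P (quotient_game c) B]%classic.

(* When P is a partition, this union has exactly one term. *)
Definition union_of P (i : X) : {fset X} := \bigcup_(B <- P | i \in B) B.

Definition coalitional_tijs N c P (i : X) : R :=
  let B := union_of P i in
  interp (ctijs_min N c P B i) (marg N c i) (ctijs_coef N c P B).

End CoalitionalGames.

(** * Generalized highway problems *)

(* A and S are the universes from which agents and sections are drawn.
   A finite ordered set of sections is the duplicate-free sequence of its
   elements in increasing order. *)
Record highway_data (R : realType) (A S : choiceType) := HighwayData {
  agents : {fset A};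
  sections : seq S;
  cost : {fsfun S -> R with 0};
  uses : {fsfun A -> {fset S} with fset0}
}.

Section Highway.
Variables (R : realType) (A S : choiceType).
Implicit Types (G : highway_data R A S).

Definition sset G : {fset S} := [fset t in sections G].

(* T(H) *)
Definition usedby G (H : {fset A}) : {fset S} := \bigcup_(i <- H) uses G i.

(* C(K') *)
Definition total_cost G (K' : {fset S}) : R := \sum_(t <- K') cost G t.

Definition cost_game G (H : {fset A}) : R := total_cost G (usedby G H).

(* The functions C on K and T on N are extended by 0 and by the empty set; the
   support conditions make this representation unique, so that Leibniz equality
   of the data is equality of the 4-tuples. As T takes nonempty values on N, the
   support of its extension is exactly N. *)
Definition is_highway G : bool :=
  [&& sections G != [::], uniq (sections G),
      all (fun t => 0 <= cost G t) (sections G),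
      finsupp (cost G) `<=` sset G,
      finsupp (uses G) == agents G
    & usedby G (agents G) == sset G].

Definition restr_agents G (K' : {fset S}) : {fset A} :=
  [fset i in agents G | uses G i `&` K' != fset0].

Definition restr G (K' : {fset S}) : highway_data R A S :=
  HighwayData
    (restr_agents G K')
    [seq t <- sections G | t \in K']
    [fsfun t in K' => cost G t | 0]
    [fsfun i in restr_agents G K' => uses G i `&` K' | fset0].

Definition restr_unions G (P : {fset {fset A}}) (K' : {fset S}) :
    {fset {fset A}} :=
  [fset B `&` restr_agents G K' | B in P & usedby G B `&` K' != fset0].

End Highway.

(* An element of HE^*. *)
Record problem (R : realType) (A S : choiceType) := Problem {
  hw :> highway_data R A S;
  unions : {fset {fset A}};
  problem_highway : is_highway hw;
  problem_partition : is_partition unions (agents hw)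
}.

Section Sections.
Variables (R : realType) (A S : choiceType).
Implicit Types (G : problem R A S).

Definition users G (t : S) : {fset A} := [fset j in agents G | t \in uses G j].
Definition exclusive G : {fset S} := [fset t in sset G | #|` users G t| == 1%N].
Definition shared G : {fset S} := sset G `\` exclusive G.
Definition excl_uses G (H : {fset A}) : {fset S} :=
  \bigcup_(i <- H) (uses G i `&` exclusive G).
Definition shared_cost G (i : A) : R := total_cost G (uses G i `&` shared G).

Definition uusers G (t : S) : {fset {fset A}} :=
  [fset B in unions G | t \in usedby G B].
Definition uexclusive G : {fset S} :=
  [fset t in sset G | #|` uusers G t| == 1%N].
Definition ushared G : {fset S} := sset G `\` uexclusive G.
Definition uexcl_uses G : {fset S} :=
  \bigcup_(B <- unions G) (usedby G B `&` uexclusive G).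
Definition ushared_cost G (B : {fset A}) : R :=
  total_cost G (usedby G B `&` ushared G).

End Sections.

(** * Solutions and their properties *)

Definition solution (R : realType) (A S : choiceType) :=
  forall G : problem R A S, {ffun agents G -> R}.

Section Solutions.
Variables (R : realType) (A S : choiceType).
Implicit Types (G : problem R A S) (sigma : solution R A S).

Definition payoff sigma G (j : A) : R :=
  if insub j is Some u then sigma G u else 0.

Definition coalitional_tijs_solution : solution R A S :=
  fun G => [ffun i => coalitional_tijs (agents G) (cost_game G) (unions G) (val i)].

Definition PO sigma : Prop :=
  forall G, \sum_(i <- agents G) payoff sigma G i = total_cost G (sset G).

Definition PSSA sigma : Prop :=
  forall G (B : {fset A}), B \in unions G -> excl_uses G B = fset0 ->
  exists2 k : R, 0 <= k &
    forall i, i \in B -> payoff sigma G i = k * shared_cost G i.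

Definition PSSU sigma : Prop :=
  forall G, uexcl_uses G = fset0 ->
  exists2 k : R, 0 <= k &
    forall B, B \in unions G ->
      \sum_(i <- B) payoff sigma G i = k * ushared_cost G B.

(* (Gamma, P) arises from (Gamma', P') by deleting the section t. *)
Definition deletes_section G G' (t : S) : Prop :=
  [/\ t \notin sset G, sset G' = t |` sset G,
      hw G = restr G' (sset G)
    & unions G = restr_unions G' (unions G') (sset G)].

Definition CPEA sigma : Prop :=
  forall G G' (i : A) (t : S),
  i \in agents G' -> deletes_section G G' t -> users G' t = [fset i] ->
  payoff sigma G' i = payoff sigma G i + cost G' t /\
  (forall j, j \in agents G' `\ i -> payoff sigma G' j = payoff sigma G j).

Definition CPEU sigma : Prop :=
  forall G G' (B : {fset A}) (t : S),
  B \in unions G' -> deletes_section G G' t -> uusers G' t = [fset B] ->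
  \sum_(i <- B) payoff sigma G' i = \sum_(i <- B) payoff sigma G i + cost G' t /\
  (forall B', B' \in unions G' `\ B ->
     \sum_(i <- B') payoff sigma G' i = \sum_(i <- B') payoff sigma G i).

End Solutions.

(* Main.v *)
Require Import Defs.
From mathcomp Require Import all_boot all_order all_algebra finmap.
From mathcomp Require Import all_classical all_reals.
From mathcomp Require Import ring lra.

Set Implicit Arguments.
Unset Strict Implicit.
Unset Printing Implicit Defensive.

Import Order.TTheory GRing.Theory Num.Theory.

Local Open Scope fset_scope.
Local Open Scope ring_scope.

(* In a highway game the minimal right of an agent is the stand-alone cost
   C(T(i)) and the utopia value is the cost of the exclusive sections of i, so
   the value of i is "exclusive cost + k * cost of the sections i shares", with
   one k per union; the union totals have the same form in the quotient game,
   which is again a highway game.  Deleting an exclusive section leaves the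
   shared costs unchanged, and proportional vectors with equal sums are equal:
   this gives CPEU and CPEA.  Conversely, two solutions with the five properties
   agree on the union totals, then on the agents: delete exclusive sections one
   at a time until none is left, where PSSU (resp. PSSA) and PO determine the
   totals (resp. the payoffs), or until only one section remains. *)

(** * Sums over finite sets, proportional vectors and interpolation coefficients *)

Lemma fset_sum_sub (V : nmodType) (T : choiceType) (B K : {fset T}) (P : pred T)
    (F : T -> V) : B `<=` K ->
  \sum_(t <- B | P t) F t = \sum_(t <- K | P t && (t \in B)) F t.
Proof.
move=> /fsubsetP sBK; rewrite [LHS]big_fset_condE [RHS]big_fset_condE.
apply: eq_fbigl => t; rewrite !inE /=.
by case tB: (t \in B); rewrite /= ?andbF ?andbT // (sBK _ tB).
Qed.

(* The case k = k' or f = g = 0, according as the weights vanish or not. *)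
Lemma proportional_eq (R : realType) (T : choiceType) (H : {fset T})
    (f g w : T -> R) (k k' : R) :
  (forall i, i \in H -> 0 <= w i) ->
  (forall i, i \in H -> f i = k * w i) ->
  (forall i, i \in H -> g i = k' * w i) ->
  \sum_(i <- H) f i = \sum_(i <- H) g i ->
  forall i, i \in H -> f i = g i.
Proof.
move=> w0 fE gE.
rewrite [LHS](eq_big_seq _ fE) [RHS](eq_big_seq _ gE) -!mulr_sumr => E i iH.
have [W0|W0] := eqVneq (\sum_(i <- H) w i) 0; last first.
  by rewrite fE // gE // (mulIf W0 E).
suff wi0 : w i = 0 by rewrite fE // gE // wi0 !mulr0.
apply/le_anti; rewrite w0 // andbT -W0 (big_fsetD1 i) //= lerDl.
by rewrite big_seq; apply: sumr_ge0 => j; rewrite !inE => /andP[_ /w0].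
Qed.

(** The sum is affine in [a], going from the sum of [m] at 0 down to the sum of [M] at 1, so it
    takes every value in between. *)
Lemma interp_coef_exists (R : realType) (T : choiceType) (H : {fset T})
    (m M : T -> R) (v : R) :
  \sum_(i <- H) M i <= v <= \sum_(i <- H) m i ->
  exists a, 0 <= a <= 1 /\ \sum_(i <- H) interp (m i) (M i) a = v.
Proof.
have sumE a : \sum_(i <- H) interp (m i) (M i) a =
    \sum_(i <- H) m i - a * (\sum_(i <- H) m i - \sum_(i <- H) M i).
  by rewrite -sumrB mulr_sumr -sumrB; apply: eq_bigr => i _; rewrite /interp; ring.
set x := \sum_(i <- H) M i; set y := \sum_(i <- H) m i => /andP[xv vy].
(* If the two sums coincide, [v] equals both and any coefficient works. *)
have [yx|yx] := eqVneq y x.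
  by exists 0; rewrite lexx ler01; split => //; rewrite sumE -/x -/y; lra.
have d0 : 0 < y - x by rewrite subr_gt0 lt_neqAle eq_sym yx (le_trans xv).
exists ((y - v) / (y - x)); split; last first.
  by rewrite sumE -/x -/y divfK ?gt_eqF //; lra.
rewrite divr_ge0 ?subr_ge0 ?(le_trans xv) //= ler_pdivrMr // mul1r; lra.
Qed.

(** * Games of the form c(H) = C(T(H)) *)

Section HighwayGame.
Variables (R : realType) (X S : choiceType).
Variables (C : S -> R) (u : X -> {fset S}) (N : {fset X}).
Hypothesis C_ge0 : forall t, 0 <= C t.

(** The players are kept abstract: they will be the agents with [u := uses G], and the unions with
    [u := usedby G] for the quotient game. *)
Definition served (H : {fset X}) : {fset S} := \bigcup_(i <- H) u i.

Definition served_cost (H : {fset X}) : R := \sum_(t <- served H) C t.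

Definition nb_users (H : {fset X}) (t : S) : nat :=
  #|` [fset j in H | t \in u j]|.

(** Users are counted in the whole of [N], so for [i] in [N] these are the sections that [i] alone
    uses. *)
Definition own (i : X) : R := \sum_(t <- u i | nb_users N t == 1%N) C t.

Definition joint (i : X) : R := \sum_(t <- u i | nb_users N t != 1%N) C t.

Lemma servedP (H : {fset X}) t :
  reflect (exists2 i, i \in H & t \in u i) (t \in served H).
Proof.
apply: (iffP (bigfcupP _ _ _ _)) => [[i /andP[iH _] ti]|[i iH ti]]; exists i => //.
by rewrite iH.
Qed.

Lemma sub_served (H : {fset X}) i : i \in H -> u i `<=` served H.
Proof. by move=> iH; apply/fsubsetP => t ti; apply/servedP; exists i. Qed.

Lemma servedS (H H' : {fset X}) : H `<=` H' -> served H `<=` served H'.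
Proof.
move=> /fsubsetP sH; apply/fsubsetP => t /servedP[i /sH iH' ti].
by apply/servedP; exists i.
Qed.

Lemma nb_users_gt0 H t : (0 < nb_users H t)%N = (t \in served H).
Proof.
rewrite cardfs_gt0; apply/fset0Pn/servedP => [[i]|[i iH ti]].
  by rewrite !inE /= => /andP[iH ti]; exists i.
by exists i; rewrite !inE /= iH.
Qed.

Lemma nb_usersS (H H' : {fset X}) t :
  H `<=` H' -> (nb_users H t <= nb_users H' t)%N.
Proof.
move=> /fsubsetP sH; apply/fsubset_leq_card/fsubsetP => i.
by rewrite !inE /= => /andP[/sH -> ->].
Qed.

Lemma nb_usersD1 (H : {fset X}) i t :
  i \in H -> nb_users H t = ((t \in u i) + nb_users (H `\ i) t)%N.
Proof.
move=> iH; rewrite {1}/nb_users (cardfsD1 i) !inE iH /=; congr (_ + #|` _|)%N.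
by apply/fsetP => j; rewrite !inE /= andbA.
Qed.

Lemma joint_ge0 i : 0 <= joint i. Proof. exact: sumr_ge0. Qed.

Lemma own_eq0 i : u i = fset0 -> own i = 0.
Proof. by rewrite /own big_mkcond => ->; rewrite big_seq_fset0. Qed.

Lemma joint_eq0 i : u i = fset0 -> joint i = 0.
Proof. by rewrite /joint big_mkcond => ->; rewrite big_seq_fset0. Qed.

Lemma own_joint i : \sum_(t <- u i) C t = own i + joint i.
Proof. by rewrite /own /joint (bigID (fun t => nb_users N t == 1%N)). Qed.

(** Double counting: after exchanging the sums, a section is paid once by each of its users in
    [H]. *)
Lemma sum_user_cost (H : {fset X}) (Q : pred S) :
  \sum_(i <- H) \sum_(t <- u i | Q t) C t =
  \sum_(t <- served H | Q t) C t *+ nb_users H t.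
Proof.
under eq_big_seq => i iH do rewrite (fset_sum_sub _ _ (sub_served iH)).
rewrite (exchange_big_dep Q) /=; last by move=> i t _ /andP[].
apply: eq_bigr => t Qt; rewrite Qt /= /nb_users card_fset_sum1 big_fset /=.
by rewrite -sumrMnr.
Qed.

(** A section served by [H] with a single user in [N] has exactly one user in [H], so the double
    count has multiplicity 1. *)
Lemma sum_own_sub (H : {fset X}) : H `<=` N ->
  \sum_(i <- H) own i = \sum_(t <- served H | nb_users N t == 1%N) C t.
Proof.
move=> sHN; rewrite sum_user_cost big_seq_cond [RHS]big_seq_cond.
apply: eq_bigr => t /andP[tH /eqP n1].
suff -> : nb_users H t = 1%N by [].
by apply/eqP; rewrite eqn_leq nb_users_gt0 tH andbT -n1 nb_usersS.
Qed.

Lemma sum_own_le (H : {fset X}) : H `<=` N ->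
  \sum_(i <- H) own i <= served_cost H.
Proof.
move=> sHN; rewrite sum_own_sub // /served_cost.
by rewrite [leRHS](bigID (fun t => nb_users N t == 1%N)) /= lerDl sumr_ge0.
Qed.

Lemma le_sum_own_joint (H : {fset X}) :
  served_cost H <= \sum_(i <- H) (own i + joint i).
Proof.
under eq_bigr do rewrite -own_joint.
rewrite (sum_user_cost H predT) /served_cost big_seq [leRHS]big_seq.
apply: ler_sum => t; rewrite -nb_users_gt0 => n0.
by rewrite -[leLHS]mulr1n ler_wpMn2l.
Qed.

(** When [i] leaves, the sections that cease to be served are those that nobody else uses. *)
Lemma marg_served_cost i : i \in N -> marg N served_cost i = own i.
Proof.
move=> iN; rewrite /marg /served_cost /own.
rewrite (bigID (fun t => t \in served (N `\ i))) /=.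
rewrite (fset_sum_sub predT C (servedS (fsubD1set N i))) /=.
rewrite addrAC subrr add0r.
rewrite (fset_sum_sub _ _ (sub_served iN)) big_seq_cond [RHS]big_seq_cond.
apply: eq_bigl => t; apply: andb_id2l => tN.
rewrite -nb_users_gt0 (nb_usersD1 t iN).
have : (0 < nb_users N t)%N by rewrite nb_users_gt0.
rewrite (nb_usersD1 t iN).
by case: (t \in u i); case: (nb_users _ _) => [|[|n]]; rewrite ?andbF ?andbT.
Qed.

(* The sections exclusive to the members of H other than i are not used by i. *)
Lemma excess_served_cost_ge (H : {fset X}) i : H `<=` N -> i \in H ->
  \sum_(t <- u i) C t <= excess N served_cost i H.
Proof.
move=> sHN iH; have sH'N : H `\ i `<=` N := fsubset_trans (fsubD1set H i) sHN.
rewrite /excess (eq_big_seq own) /=; last first.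
  by move=> j /(fsubsetP sH'N); exact: marg_served_cost.
rewrite sum_own_sub // lerBrDr /served_cost.
rewrite (fset_sum_sub predT C (sub_served iH)) /=.
rewrite (fset_sum_sub _ C (servedS (fsubD1set H i))) /=.
rewrite [leRHS](bigID (fun t => t \in u i)) /= lerD2l big_seq_cond.
rewrite [leLHS](_ : _ = \sum_(t <- served H | (t \notin u i) &&
    ((nb_users N t == 1%N) && (t \in served (H `\ i)))) C t); last first.
  rewrite [RHS]big_seq_cond; apply: eq_bigl => t; apply: andb_id2l => _.
  case: eqP => //= n1; last by rewrite andbF.
  case tH: (t \in served _); rewrite ?andbF // andbT.
  (* Otherwise [i] and another member of [H] both use [t], which then has at least two users in
     [N]. *)
  apply/esym/negP => ti; move: n1.
  have := nb_usersS t sH'N; rewrite (nb_usersD1 t (fsubsetP sHN _ iH)) ti.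
  rewrite -nb_users_gt0 in tH; move: tH.
  have : (nb_users (H `\ i) t <= nb_users (N `\ i) t)%N.
    by apply: nb_usersS; apply: fsetSD.
  by case: (nb_users (H `\ i) t); case: (nb_users (N `\ i) t).
rewrite [leRHS](bigID (fun t => (nb_users N t == 1%N)
  && (t \in served (H `\ i)))) /=.
by rewrite lerDl sumr_ge0.
Qed.

(** The lower bound [excess_served_cost_ge] is attained at the singleton of [i]. The family [F] is
    left general to cover both the power set and the coalitions compatible with a union. *)
Lemma min_excess_served_cost (F : {fset {fset X}}) i : i \in N ->
  [fset i] \in F -> (forall H, H \in F -> H `<=` N) ->
  min_excess N served_cost F i = \sum_(t <- u i) C t.
Proof.
move=> iN iF FN; apply/le_anti/andP; split; last first.
  set c := \sum_(t <- _) _; rewrite /min_excess big_seq_cond.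
  apply: (big_rec (fun x => c <= x)) => [|H x].
    (* The seed of the iterated minimum is the excess at [N]. *)
    exact: excess_served_cost_ge (fsubset_refl N) iN.
  by case/andP=> /FN sH iH le_x; rewrite le_min le_x excess_served_cost_ge.
apply: (bigmin_inf_seq _ [fset i]) => //; first by rewrite inE.
rewrite /excess fsetDv big_seq_fset0 subr0 /served_cost /served.
by rewrite big_seq_fset1.
Qed.

(** Serves both values: the Tijs value with [H = N], and the coalitional one with [H] a union and
    [v] its quotient payoff. Since [m] is [own + joint] and the marginal is [own], interpolating
    with [a] charges the fraction [1 - a] of [joint]. *)
Lemma interp_coefP (H : {fset X}) (m : X -> R) (v : R) :
  {in H, forall i, m i = \sum_(t <- u i) C t} -> H `<=` N ->
  \sum_(i <- H) own i <= v <= \sum_(i <- H) (own i + joint i) ->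
  let a := xget 0 [set a : R | 0 <= a <= 1 /\
    \sum_(i <- H) interp (m i) (marg N served_cost i) a = v]%classic in
  [/\ 0 <= 1 - a <= 1,
      {in H, forall i,
        interp (m i) (marg N served_cost i) a = own i + (1 - a) * joint i}
    & \sum_(i <- H) interp (m i) (marg N served_cost i) a = v].
Proof.
move=> mE /fsubsetP sHN v_bnd a.
have interpE b : {in H, forall i,
    interp (m i) (marg N served_cost i) b = interp (own i + joint i) (own i) b}.
  by move=> i iH; rewrite mE // own_joint marg_served_cost // sHN.
have ex_a : exists b : R, 0 <= b <= 1 /\
    \sum_(i <- H) interp (m i) (marg N served_cost i) b = v.
  have [b [b01 bE]] := interp_coef_exists v_bnd.
  by exists b; split => //; rewrite -bE; apply: eq_big_seq.
(* As a coefficient exists, [xget] returns a genuine one and not merely its default 0. *)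
have [a01 aE] := xgetPex (0 : R) ex_a; rewrite -/a in a01 aE.
split => //; first by lra.
by move=> i iH; rewrite interpE // /interp; ring.
Qed.

Lemma tijs_served_costE :
  (exists2 k, 0 <= k <= 1 &
     {in N, forall i, tijs N served_cost i = own i + k * joint i}) /\
  \sum_(i <- N) tijs N served_cost i = served_cost N.
Proof.
have [||a01 aE aS] :=
    @interp_coefP N (tijs_min N served_cost) (served_cost N) _ (fsubset_refl N).
- move=> i iN; apply: min_excess_served_cost; rewrite ?fpowersetE ?fsub1set //.
  by move=> H; rewrite fpowersetE.
- by rewrite sum_own_le //= le_sum_own_joint.
- by split=> //; exists (1 - tijs_coef N served_cost).
Qed.

End HighwayGame.

Lemma sum_if_pred1 (V : nmodType) (T : choiceType) (H : {fset T}) (x : T) (c : V) :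
  \sum_(i <- H) (if i == x then c else 0) = if x \in H then c else 0.
Proof.
have [xH|xH] := boolP (x \in H).
  rewrite (big_fsetD1 x) //= eqxx big_seq big1 ?addr0 // => i.
  by rewrite !inE => /andP[/negPf ->].
rewrite big_seq big1 // => i iH; case: eqP => // ix.
by rewrite -ix iH in xH.
Qed.

(** * Exclusive and shared costs of agents and unions *)

Section HighwayData.
Variables (R : realType) (A S : choiceType).
Implicit Types (D : highway_data R A S) (G : problem R A S).

Lemma usedbyP D (H : {fset A}) t :
  reflect (exists2 i, i \in H & t \in uses D i) (t \in usedby D H).
Proof. exact: servedP. Qed.

(** Brings the quotient game under the preceding results, with the unions as players. *)
Lemma quotient_cost_game D :
  quotient_game (cost_game D) = served_cost (cost D) (usedby D).
Proof.
apply: funext => L; rewrite /quotient_game /cost_game /total_cost /served_cost.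
congr (\sum_(t <- enum_fset _) _); apply/fsetP => t.
apply/usedbyP/servedP.
  move=> [i /bigfcupP[B /andP[BL _] iB] ti].
  by exists B => //; apply/usedbyP; exists i.
move=> [B BL /usedbyP[i iB ti]]; exists i => //.
by apply/bigfcupP; exists B; rewrite ?BL.
Qed.

Lemma cost_ge0 G t : 0 <= cost G t.
Proof.
have /and5P[_ _ /allP c0 sC _] := problem_highway G.
have [tC|/fsfun_dflt -> //] := boolP (t \in finsupp (cost G)).
by apply: c0; have := fsubsetP sC _ tC; rewrite inE.
Qed.

Lemma mem_agents G i : (i \in agents G) = (uses G i != fset0).
Proof.
have /and5P[_ _ _ _ /andP[/eqP <- _]] := problem_highway G.
by rewrite mem_finsupp.
Qed.

Lemma usedby_agents G : usedby G (agents G) = sset G.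
Proof. by have /and5P[_ _ _ _ /andP[_ /eqP]] := problem_highway G. Qed.

Lemma uses_sub G i : uses G i `<=` sset G.
Proof.
rewrite -usedby_agents; have [iN|] := boolP (i \in agents G).
  exact: sub_served.
by rewrite mem_agents negbK => /eqP ->; exact: fsub0set.
Qed.

Lemma usedby_sub G (B : {fset A}) : usedby G B `<=` sset G.
Proof.
apply/fsubsetP => t /usedbyP[i _]; exact: (fsubsetP (uses_sub G i)).
Qed.

Lemma usedbyI G (B : {fset A}) : usedby G (B `&` agents G) = usedby G B.
Proof.
apply/fsetP => t; apply/usedbyP/usedbyP => -[i iB ti]; exists i => //.
  by move: iB; rewrite inE => /andP[].
by rewrite inE iB mem_agents; apply/fset0Pn; exists t.
Qed.

Lemma fcover_unions G : fcover (unions G) = agents G.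
Proof. by have /and3P[_ _ /eqP] := problem_partition G. Qed.

Lemma unions_sub G B : B \in unions G -> B `<=` agents G.
Proof.
move=> BP; rewrite -fcover_unions; apply/fsubsetP => i iB.
by apply/bigfcupP; exists B; rewrite ?BP.
Qed.

Lemma unions_neq0 G B : B \in unions G -> exists i, i \in B.
Proof.
move=> BP; apply/fset0Pn; apply: contraTneq BP => ->.
by have /and3P[] := problem_partition G.
Qed.

Lemma unions_inj G B B' i : B \in unions G -> B' \in unions G ->
  i \in B -> i \in B' -> B = B'.
Proof.
move=> BP BP' iB iB'; have /and3P[_ /trivIfsetP tP _] := problem_partition G.
by apply/eqP; apply: contraTT iB' => /(tP _ _ BP BP')/fdisjointP; apply.
Qed.

Lemma union_exists G i : i \in agents G -> exists2 B, B \in unions G & i \in B.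
Proof. by rewrite -fcover_unions => /bigfcupP[B /andP[]]; exists B. Qed.

Lemma union_ofE G B i : B \in unions G -> i \in B -> union_of (unions G) i = B.
Proof.
move=> BP iB; apply/fsetP => j; apply/bigfcupP/idP => [[B' /andP[BP' iB']]|jB].
  by rewrite (unions_inj BP BP' iB iB').
by exists B; rewrite ?BP.
Qed.

Lemma sum_unions G (f : A -> R) :
  \sum_(B <- unions G) \sum_(i <- B) f i = \sum_(i <- agents G) f i.
Proof.
rewrite -fcover_unions big_trivIfset //.
by have /and3P[] := problem_partition G.
Qed.

Lemma served_usedby_unions G : served (usedby G) (unions G) = sset G.
Proof.
rewrite -usedby_agents; apply/fsetP => t; apply/servedP/usedbyP.
  move=> [B BP /usedbyP[i iB ti]]; exists i => //.
  exact: (fsubsetP (unions_sub BP)).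
move=> [i /union_exists[B BP iB] ti]; exists B => //.
by apply/usedbyP; exists i.
Qed.

Definition agent_own G i : R := own (cost G) (uses G) (agents G) i.
Definition agent_joint G i : R := joint (cost G) (uses G) (agents G) i.
Definition union_own G B : R := own (cost G) (usedby G) (unions G) B.
Definition union_joint G B : R := joint (cost G) (usedby G) (unions G) B.

Lemma shared_costE G i : shared_cost G i = agent_joint G i.
Proof.
rewrite /shared_cost /total_cost /agent_joint /joint.
rewrite (fset_sum_sub predT _ (fsubsetIl _ _)) /=.
rewrite big_seq_cond [RHS]big_seq_cond; apply: eq_bigl => t.
apply: andb_id2l => ti; have := fsubsetP (uses_sub G i) _ ti.
by rewrite !inE ti => ->; rewrite !andbT.
Qed.

Lemma ushared_costE G B : ushared_cost G B = union_joint G B.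
Proof.
rewrite /ushared_cost /total_cost /union_joint /joint.
rewrite (fset_sum_sub predT _ (fsubsetIl _ _)) /=.
rewrite big_seq_cond [RHS]big_seq_cond; apply: eq_bigl => t.
apply: andb_id2l => ti; have := fsubsetP (usedby_sub G B) _ ti.
by rewrite !inE ti => ->; rewrite !andbT.
Qed.

Lemma agent_own_eq0 G (B : {fset A}) i :
  excl_uses G B = fset0 -> i \in B -> agent_own G i = 0.
Proof.
move=> E iB; rewrite /agent_own /own big_seq_cond big1 // => t /andP[ti n1].
have : t \in excl_uses G B.
  apply/bigfcupP; exists i; first by rewrite iB.
  by have := fsubsetP (uses_sub G i) _ ti; rewrite !inE ti => ->.
by rewrite E inE.
Qed.

Lemma union_own_eq0 G B :
  uexcl_uses G = fset0 -> B \in unions G -> union_own G B = 0.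
Proof.
move=> E BP; rewrite /union_own /own big_seq_cond big1 // => t /andP[ti n1].
have : t \in uexcl_uses G.
  apply/bigfcupP; exists B; first by rewrite BP.
  by have := fsubsetP (usedby_sub G B) _ ti; rewrite !inE ti => ->.
by rewrite E inE.
Qed.

(** Lets the deletion of a section exclusive to an agent be treated as a deletion at the level of
    unions. *)
Lemma uusers_users1 G B i t : B \in unions G -> i \in B ->
  users G t = [fset i] -> uusers G t = [fset B].
Proof.
move=> BP iB ut; apply/fsetP => B'; rewrite !inE /=.
have usE j : (j \in agents G) && (t \in uses G j) = (j == i).
  by have /fsetP/(_ j) := ut; rewrite !inE.
apply/andP/eqP => [[BP' /usedbyP[j jB' tj]]|->].
  apply: (unions_inj BP' BP jB'); suff /eqP -> : j == i by [].
  by rewrite -usE tj (fsubsetP (unions_sub BP')).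
split=> //; apply/usedbyP; exists i => //.
by have := usE i; rewrite eqxx => /andP[].
Qed.

End HighwayData.

(** * Deleting sections *)

Section Restriction.
Variables (R : realType) (A S : choiceType).
Variables (G : problem R A S) (K : {fset S}).

Lemma mem_restr_agents i : (i \in restr_agents G K) = (uses G i `&` K != fset0).
Proof.
rewrite !inE /=; apply: andb_idl => /fset0Pn[t]; rewrite inE => /andP[ti _].
by rewrite mem_agents; apply/fset0Pn; exists t.
Qed.

Lemma uses_restr i : uses (restr G K) i = uses G i `&` K.
Proof.
by rewrite fsfun_fun mem_restr_agents; case: ifPn => //; rewrite negbK => /eqP.
Qed.

Lemma cost_restr t : t \in K -> cost (restr G K) t = cost G t.
Proof. by move=> tK; rewrite fsfun_fun tK. Qed.

Lemma usedby_restr (H : {fset A}) : usedby (restr G K) H = usedby G H `&` K.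
Proof.
apply/fsetP => t; rewrite inE; apply/usedbyP/andP.
  move=> [i iH]; rewrite uses_restr inE => /andP[ti tK].
  by split=> //; apply/usedbyP; exists i.
by case=> /usedbyP[i iH ti] tK; exists i => //; rewrite uses_restr inE ti.
Qed.

Lemma users_restr t : t \in K ->
  [fset j in agents (restr G K) | t \in uses (restr G K) j] = users G t.
Proof.
move=> tK; apply/fsetP => j; rewrite !inE /= uses_restr inE tK andbT -andbA.
apply: andb_id2l => jN; apply: andb_idl => tj.
by apply/fset0Pn; exists t; rewrite inE tj.
Qed.

Lemma mem_restr_unions B :
  reflect (exists2 B0, B0 \in unions G /\ usedby G B0 `&` K != fset0
                     & B = B0 `&` restr_agents G K)
          (B \in restr_unions G (unions G) K).
Proof.
apply: (iffP (imfsetP _ _ _ _)) => [[B0 /=]|[B0 [BP uB] ->]].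
  by rewrite !inE => /andP[BP uB] ->; exists B0.
by exists B0; rewrite // !inE /= BP.
Qed.

Lemma restr_union_neq0 (B : {fset A}) :
  (usedby G B `&` K != fset0) = (B `&` restr_agents G K != fset0).
Proof.
apply/fset0Pn/fset0Pn => [[t]|[i]].
  rewrite inE => /andP[/usedbyP[i iB ti] tK]; exists i.
  by rewrite inE iB mem_restr_agents; apply/fset0Pn; exists t; rewrite inE ti.
rewrite inE mem_restr_agents => /andP[iB /fset0Pn[t]]; rewrite inE => /andP[ti tK].
by exists t; rewrite inE tK andbT; apply/usedbyP; exists i.
Qed.

Lemma usedby_restrI (B : {fset A}) :
  usedby (restr G K) (B `&` restr_agents G K) = usedby G B `&` K.
Proof.
apply/fsetP => t; rewrite usedby_restr !inE; apply: andb_id2r => tK.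
apply/usedbyP/usedbyP => -[i iB ti]; exists i => //.
  by move: iB; rewrite inE => /andP[].
by rewrite inE iB mem_restr_agents; apply/fset0Pn; exists t; rewrite inE ti.
Qed.

(** Intersecting with the remaining agents is injective on the unions that use [t]: each keeps a
    user of [t], and distinct unions are disjoint. *)
Lemma card_uusers_restr t : t \in K ->
  #|` [fset B in restr_unions G (unions G) K | t \in usedby (restr G K) B]| =
  #|` uusers G t|.
Proof.
move=> tK.
have -> : [fset B in restr_unions G (unions G) K | t \in usedby (restr G K) B] =
    [fset B `&` restr_agents G K | B in uusers G t].
  apply/fsetP => B; rewrite !inE /=; apply/andP/imfsetP => /=.
    case=> /mem_restr_unions[B0 [BP _] ->].
    rewrite usedby_restrI inE => /andP[tB _].
    by exists B0; rewrite // !inE BP.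
  case=> B0; rewrite !inE /= => /andP[BP tB] ->; split; last first.
    by rewrite usedby_restrI inE tB.
  by apply/mem_restr_unions; exists B0; split=> //;
     apply/fset0Pn; exists t; rewrite inE tB.
rewrite card_in_imfset //= => B B'; rewrite !inE /=.
move=> /andP[BP tB] /andP[BP' _] /fsetP BB'.
have : B `&` restr_agents G K != fset0.
  by rewrite -restr_union_neq0; apply/fset0Pn; exists t; rewrite inE tB.
case/fset0Pn => i iB; have := BB' i; rewrite iB => /esym.
rewrite inE => /andP[iB' _].
by move: iB; rewrite inE => /andP[iB _]; apply: (unions_inj BP BP' iB).
Qed.

Hypotheses (sK : K `<=` sset G) (K0 : K != fset0).

Lemma sset_restr : sset (restr G K) = K.
Proof.
apply/fsetP => t; rewrite !inE /= mem_filter; apply: andb_idr => tK.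
by have := fsubsetP sK _ tK; rewrite inE.
Qed.

Lemma restr_highway : is_highway (restr G K).
Proof.
have /and5P[_ un /allP c0 _ _] := problem_highway G.
apply/and5P; split; last (apply/andP; split).
- apply: contraNneq K0 => E; apply/eqP/fsetP => t.
  by rewrite -sset_restr !inE E.
- exact: filter_uniq.
- apply/allP => t; rewrite mem_filter => /andP[tK tG].
  by rewrite cost_restr // c0.
- rewrite sset_restr; apply/fsubsetP => t; rewrite mem_finsupp fsfun_fun.
  by case: ifP => //; rewrite eqxx.
- apply/eqP/fsetP => i; rewrite mem_finsupp uses_restr /=.
  by rewrite mem_restr_agents.
- apply/eqP/fsetP => t; rewrite sset_restr /=.
  (* The remaining agents are written as an intersection with [agents G] so that [usedby_restrI]
     applies. *)
  rewrite -[X in usedby _ X](fsetIidPr (_ : _ `<=` agents G)); last exact: fset_sub.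
  rewrite usedby_restrI usedby_agents inE; apply: andb_idl; exact: (fsubsetP sK).
Qed.

Lemma restr_partition :
  is_partition (restr_unions G (unions G) K) (agents (restr G K)).
Proof.
apply/and3P; split.
- apply/negP => /mem_restr_unions[B [BP]]; rewrite restr_union_neq0.
  by move=> + E; rewrite -E eqxx.
- apply/trivIfsetP => B1 B2 /mem_restr_unions[B [BP _] ->].
  move=> /mem_restr_unions[B' [BP' _] ->] neq.
  apply/fdisjointP => i; rewrite !inE => /andP[iB _].
  apply/negP => /andP[iB' _]; move: neq.
  by rewrite (unions_inj BP BP' iB iB') eqxx.
- apply/eqP/fsetP => i; apply/bigfcupP/idP => /=.
    move=> [_ /andP[/mem_restr_unions[B _ ->] _]]; by rewrite inE => /andP[].
  move=> iN; have iG : i \in agents G by move: iN; rewrite !inE => /andP[].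
  have [B BP iB] := union_exists iG.
  have iI : i \in B `&` restr_agents G K by rewrite inE iB.
  exists (B `&` restr_agents G K) => //; rewrite andbT; apply/mem_restr_unions.
  by exists B => //; split => //; rewrite restr_union_neq0; apply/fset0Pn; exists i.
Qed.

End Restriction.

(** Induction step for uniqueness. A problem must have a section, whence the condition that [t] is
    not the only one. *)
Lemma restr_problem_exists (R : realType) (A S : choiceType) (G : problem R A S) t :
  t \in sset G -> sset G != [fset t] ->
  exists2 G0 : problem R A S, deletes_section G0 G t &
    (#|` sset G0| < #|` sset G|)%N.
Proof.
move=> tG nt; set K := sset G `\ t.
have sK : K `<=` sset G := fsubD1set _ _.
have K0 : K != fset0.
  apply: contra nt => /eqP E; apply/eqP.
  by rewrite -(fsetD1K tG) -/K E fsetU0.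
exists (Problem (restr_highway sK K0) (restr_partition G K)).
  rewrite /deletes_section /= (sset_restr sK); split=> //.
    by rewrite !inE eqxx.
  by rewrite fsetD1K.
by rewrite /= (sset_restr sK) (cardfsD1 t (sset G)) tG.
Qed.

(** * Effect of a deletion on exclusive and shared costs *)

Lemma delete_term (R : zmodType) (S : choiceType) (U U' : {fset S}) (Q Q' : pred S)
    (C C' : S -> R) (K : {fset S}) t :
  t \notin K -> U' `<=` t |` K -> U = U' `&` K ->
  {in K, Q =1 Q'} -> {in K, C =1 C'} ->
  \sum_(s <- U' | Q' s) C' s =
  \sum_(s <- U | Q s) C s + (if (t \in U') && Q' t then C' t else 0).
Proof.
move=> tK sU' UE QE CE.
have sumE : \sum_(s <- U | Q s) C s = \sum_(s <- U | Q' s) C' s.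
  rewrite big_seq_cond [RHS]big_seq_cond; apply: eq_big => s.
    by apply: andb_id2l; rewrite UE inE => /andP[_ sK]; rewrite QE.
  by rewrite UE inE => /andP[/andP[_ sK] _]; rewrite CE.
have tU : t \notin U by rewrite UE inE (negPf tK) andbF.
rewrite sumE; have [tU'|tU'] := boolP (t \in U') => /=.
  rewrite (_ : U' = t |` U); last first.
    apply/fsetP => s; rewrite UE !inE.
    have [->|st] := eqVneq s t; first by rewrite tU'.
    apply/esym/andb_idr => /= sU.
    by have := fsubsetP sU' _ sU; rewrite !inE (negPf st).
  by rewrite big_mkcond /= big_fsetU1 // -big_mkcond /= addrC.
rewrite addr0 (_ : U' = U) //.
apply/fsetP => s; rewrite UE inE; apply/esym/andb_idr => sU.
have := fsubsetP sU' _ sU; rewrite !inE => /orP[/eqP st|//].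
by rewrite st (negPf tU') in sU.
Qed.

(** The numbers of users and the costs agree on [K], so only the term of [t] can differ; having one
    user, [t] counts in [own] and never in [joint]. *)
Lemma own_joint_delete (R : realType) (X S : choiceType) (C C' : S -> R)
    (u u' : X -> {fset S}) (N N' : {fset X}) (x x' : X) (K : {fset S}) t :
  t \notin K -> u' x' `<=` t |` K -> u x = u' x' `&` K ->
  {in K, nb_users u N =1 nb_users u' N'} -> {in K, C =1 C'} ->
  nb_users u' N' t = 1%N ->
  own C' u' N' x' = own C u N x + (if t \in u' x' then C' t else 0) /\
  joint C' u' N' x' = joint C u N x.
Proof.
move=> tK sU uE nE CE nt; rewrite /own /joint.
split.
  rewrite (delete_term tK sU uE _ CE (Q := fun s => nb_users u N s == 1%N)).
    by rewrite nt eqxx andbT.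
  by move=> s /nE ->.
rewrite (delete_term tK sU uE _ CE (Q := fun s => nb_users u N s != 1%N)).
  by rewrite nt eqxx andbF addr0.
by move=> s /nE ->.
Qed.

Section Deletion.
Variables (R : realType) (A S : choiceType).
Variables (G G' : problem R A S) (t : S).
Hypothesis del : deletes_section G G' t.

Let K := sset G.

Lemma agents_del : agents G = restr_agents G' K.
Proof. by have [_ _ E _] := del; rewrite E. Qed.

Lemma usedby_del : usedby G = fun H => usedby G' H `&` K.
Proof. by apply: funext => H; have [_ _ E _] := del; rewrite E usedby_restr. Qed.

Lemma usedby_delI (B : {fset A}) : usedby G (B `&` agents G) = usedby G' B `&` K.
Proof. by rewrite usedbyI usedby_del. Qed.

Lemma users_del s : s \in K -> users G s = users G' s.
Proof.
by move=> sK; have [_ _ E _] := del; rewrite -(users_restr G' sK) -/K -E.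
Qed.

Lemma card_uusers_del s : s \in K -> #|` uusers G s| = #|` uusers G' s|.
Proof.
move=> sK; have [_ _ E E'] := del.
by rewrite -(card_uusers_restr G' sK) -/K -E' -E.
Qed.

(** Here [j] is arbitrary: an agent who disappears with [t] has no section in [G], hence zero costs
    there. *)
Lemma agent_own_del i : users G' t = [fset i] -> forall j,
  agent_own G' j = agent_own G j + (if j == i then cost G' t else 0) /\
  agent_joint G' j = agent_joint G j.
Proof.
move=> ut j; have [tK KE E _] := del.
have nE : {in K, nb_users (uses G) (agents G) =1 nb_users (uses G') (agents G')}.
  by move=> s sK; rewrite /nb_users; congr #|` _|; apply: users_del.
have CE : {in K, cost G =1 cost G'}.
  by move=> s sK; rewrite E cost_restr.
have nt : nb_users (uses G') (agents G') t = 1%N.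
  by have := cardfs1 i; rewrite -ut.
have uE : uses G j = uses G' j `&` K by rewrite E uses_restr.
have sU : uses G' j `<=` t |` K by rewrite -KE uses_sub.
have tj : (t \in uses G' j) = (j == i).
  have /fsetP/(_ j) := ut; rewrite !inE /= => <-; apply/esym/andb_idl => tj.
  by rewrite mem_agents; apply/fset0Pn; exists t.
by rewrite -tj; exact: own_joint_delete tK sU uE nE CE nt.
Qed.

Lemma union_own_del B : uusers G' t = [fset B] -> forall B', B' \in unions G' ->
  union_own G' B' =
    union_own G (B' `&` agents G) + (if B' == B then cost G' t else 0) /\
  union_joint G' B' = union_joint G (B' `&` agents G).
Proof.
move=> ut B' BP'; have [tK KE E _] := del.
have nE : {in K, nb_users (usedby G) (unions G) =1
    nb_users (usedby G') (unions G')}.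
  by move=> s sK; apply: card_uusers_del.
have CE : {in K, cost G =1 cost G'}.
  by move=> s sK; rewrite E cost_restr.
have nt : nb_users (usedby G') (unions G') t = 1%N.
  by have := cardfs1 B; rewrite -ut.
have uE := usedby_delI B'.
have sU : usedby G' B' `<=` t |` K by rewrite -KE usedby_sub.
have tj : (t \in usedby G' B') = (B' == B).
  by have /fsetP/(_ B') := ut; rewrite !inE /= BP' => <-.
by rewrite -tj; exact: own_joint_delete tK sU uE nE CE nt.
Qed.

Lemma agents_del_sub : agents G `<=` agents G'.
Proof. by rewrite agents_del; exact: fset_sub. Qed.

Lemma total_cost_del : total_cost G' (sset G') = total_cost G K + cost G' t.
Proof.
have [tK KE E _] := del; rewrite /total_cost KE big_fsetU1 //= addrC; congr (_ + _).
by apply: eq_big_seq => s sK; rewrite E cost_restr.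
Qed.

(** The second case is that of a union whose only section was [t]. *)
Lemma unions_del B : B \in unions G' ->
  (B `&` agents G \in unions G) || (B `&` agents G == fset0).
Proof.
move=> BP; case: eqP => [->|/eqP]; rewrite ?orbT // orbF => B0.
have [_ _ _ E] := del; rewrite E; apply/mem_restr_unions; exists B;
  last by rewrite -agents_del.
by split=> //; rewrite restr_union_neq0 -agents_del.
Qed.

End Deletion.

(** * The five properties of the coalitional Tijs value *)

Section Payoff.
Variables (R : realType) (A S : choiceType).
Implicit Types (G : problem R A S) (sigma : solution R A S).

Lemma payoff_out sigma G j : j \notin agents G -> payoff sigma G j = 0.
Proof. by move=> jN; rewrite /payoff insubN. Qed.

(** Absent agents are paid 0, so a union of a larger problem may replace its trace on [G]. *)
Lemma payoffI sigma G (B : {fset A}) :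
  \sum_(i <- B `&` agents G) payoff sigma G i = \sum_(i <- B) payoff sigma G i.
Proof.
apply: big_fset_incl; first exact: fsubsetIl.
by move=> i iB; rewrite inE iB /= => /payoff_out.
Qed.

Lemma solution_eqP sigma sigma' G :
  (forall i, i \in agents G -> payoff sigma G i = payoff sigma' G i) ->
  sigma G = sigma' G.
Proof.
move=> E; apply/ffunP => u; have := E _ (valP u).
by rewrite /payoff valK.
Qed.

End Payoff.

Section CoalitionalTijs.
Variables (R : realType) (A S : choiceType).
Implicit Types (G : problem R A S).

Let T := coalitional_tijs_solution (R := R) (A := A) (S := S).

Lemma payoff_tijs G i : i \in agents G ->
  payoff T G i = coalitional_tijs (agents G) (cost_game G) (unions G) i.
Proof. by move=> iN; rewrite /payoff insubT /= ffunE. Qed.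

Lemma nb_users_union1 G B t : B \in unions G -> t \in usedby G B ->
  nb_users (uses G) (agents G) t = 1%N -> nb_users (usedby G) (unions G) t = 1%N.
Proof.
move=> BP tB /eqP/cardfs1P[i uti].
have [j jB tj] := usedbyP _ _ _ tB.
have ji : j = i.
  apply/eqP; have /fsetP/(_ j) := uti; rewrite !inE /= => <-.
  by rewrite tj (fsubsetP (unions_sub BP)).
rewrite ji in jB; have := uusers_users1 BP jB uti.
by rewrite /uusers /nb_users => ->; rewrite cardfs1.
Qed.

Lemma tijs_quotientE G :
  (exists2 k, 0 <= k <= 1 &
     {in unions G, forall B,
        tijs (unions G) (quotient_game (cost_game G)) B =
          union_own G B + k * union_joint G B}) /\
  \sum_(B <- unions G) tijs (unions G) (quotient_game (cost_game G)) B
    = total_cost G (sset G).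
Proof.
have := tijs_served_costE (usedby G) (unions G) (cost_ge0 G).
rewrite [served_cost _ _ (unions G)]/served_cost served_usedby_unions.
by rewrite -quotient_cost_game.
Qed.

(** A section exclusive to a member of [B] is exclusive to [B], whereas one shared only within [B]
    counts on the right alone. *)
Lemma sum_agent_own_le G B : B \in unions G ->
  \sum_(i <- B) agent_own G i <= union_own G B.
Proof.
move=> BP; rewrite sum_own_sub ?unions_sub // /union_own /own.
rewrite big_seq_cond [leRHS]big_seq_cond.
rewrite [leRHS](bigID (fun t => nb_users (uses G) (agents G) t == 1%N)) /=.
rewrite [leLHS](_ : _ = \sum_(t <- usedby G B |
    (t \in usedby G B) && (nb_users (usedby G) (unions G) t == 1%N) &&
    (nb_users (uses G) (agents G) t == 1%N)) cost G t).
  by rewrite lerDl sumr_ge0 // => t _; exact: cost_ge0.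
apply: eq_bigl => t; rewrite -andbA; apply: andb_id2l => tB.
by apply/esym/andb_idl => /eqP n1; rewrite (nb_users_union1 BP tB n1).
Qed.

(** The quotient payoff of [B] lies between the sums of the utopia values and of the minimal rights
    of its members, so the coefficient of [B] exists. *)
Lemma coalitional_tijs_unionE G B : B \in unions G ->
  (exists2 k, 0 <= k &
     {in B, forall i, payoff T G i = agent_own G i + k * agent_joint G i}) /\
  \sum_(i <- B) payoff T G i = tijs (unions G) (quotient_game (cost_game G)) B.
Proof.
move=> BP; have sBN := unions_sub BP.
set v := tijs _ _ B.
have v_bnd : \sum_(i <- B) agent_own G i <= v <=
    \sum_(i <- B) (agent_own G i + agent_joint G i).
  have [[k /andP[k0 k1] vE] _] := tijs_quotientE G.
  have j0 : 0 <= union_joint G B by apply: joint_ge0; exact: cost_ge0.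
  rewrite /v vE //; apply/andP; split.
    by apply: (le_trans (sum_agent_own_le BP)); rewrite lerDl mulr_ge0.
  (* As [k <= 1], the payoff is at most the stand-alone cost of [B], itself at most the sum of those
     of its members. *)
  apply: le_trans (le_sum_own_joint _ _ (cost_ge0 G) B).
  by rewrite /served_cost (own_joint _ _ (unions G)) lerD2l ler_piMl.
have mE : {in B, forall i, ctijs_min (agents G) (cost_game G) (unions G) B i =
    \sum_(t <- uses G i) cost G t}.
  move=> i iB; apply: (@min_excess_served_cost _ _ _ (cost G) (uses G)).
  - exact: cost_ge0.
  - exact: (fsubsetP sBN).
  (* The singleton of [i] is compatible: no other union joins, and [T'] is that singleton. *)
  - apply/imfset2P; exists fset0; first by rewrite /= fpowersetE fsub0set.
    exists [fset i]; first by rewrite /= fpowersetE fsub1set.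
    by rewrite /fcover big_seq_fset0 fset0U.
  - move=> H /imfset2P[L /=]; rewrite fpowersetE => /fsubsetP sL [B' /=].
    rewrite fpowersetE => sB' ->; rewrite fsubUset (fsubset_trans sB') // andbT.
    apply/bigfcupsP => L' L'L _; apply: unions_sub.
    by have := sL _ L'L; rewrite !inE => /andP[].
have [/andP[a0 _] aE aS] := interp_coefP mE sBN v_bnd.
have TE : {in B, forall i, payoff T G i =
    interp (ctijs_min (agents G) (cost_game G) (unions G) B i)
      (marg (agents G) (cost_game G) i)
      (ctijs_coef (agents G) (cost_game G) (unions G) B)}.
  move=> i iB; rewrite payoff_tijs ?(fsubsetP sBN) //.
  by rewrite /coalitional_tijs (union_ofE BP iB).
split; last by rewrite (eq_big_seq _ TE).
by eexists; [exact: a0|move=> i iB; rewrite TE //; exact: aE].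
Qed.

Lemma tijs_PO : PO T.
Proof.
move=> G; rewrite -sum_unions; have [_ <-] := tijs_quotientE G.
by apply: eq_big_seq => B /coalitional_tijs_unionE[].
Qed.

Lemma tijs_PSSA : PSSA T.
Proof.
move=> G B BP E; have [[k k0 kE] _] := coalitional_tijs_unionE BP.
by exists k => // i iB; rewrite kE // (agent_own_eq0 E iB) add0r shared_costE.
Qed.

Lemma tijs_PSSU : PSSU T.
Proof.
move=> G E; have [[k /andP[k0 _] kE] _] := tijs_quotientE G.
exists k => // B BP; have [_ ->] := coalitional_tijs_unionE BP.
by rewrite kE // union_own_eq0 // add0r ushared_costE.
Qed.

(* A union that disappears with t is represented by the empty set. *)
Lemma sum_payoff_del G G' t : deletes_section G G' t -> exists k,
  {in unions G', forall B : {fset A}, \sum_(i <- B) payoff T G i =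
     union_own G (B `&` agents G) + k * union_joint G (B `&` agents G)}.
Proof.
move=> del; have [[k _ kE] _] := tijs_quotientE G; exists k => B BP.
rewrite -payoffI; have [BG|/eqP ->] := orP (unions_del del BP).
  by rewrite -kE //; have [_ ->] := coalitional_tijs_unionE BG.
have u0 : usedby G fset0 = fset0 by rewrite /usedby big_seq_fset0.
by rewrite /union_own /union_joint own_eq0 // joint_eq0 //
  big_seq_fset0 mulr0 addr0.
Qed.

(** Net of exclusive costs, the union payoffs before and after the deletion are multiples of the
    same vector of shared costs. By (PO) they have equal sums, since total and exclusive costs both
    change by the cost of [t]; hence they coincide. *)
Lemma tijs_union_del G G' B t : deletes_section G G' t -> uusers G' t = [fset B] ->
  {in unions G', forall B' : {fset A}, \sum_(i <- B') payoff T G' i =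
     \sum_(i <- B') payoff T G i + (if B' == B then cost G' t else 0)}.
Proof.
move=> del ut.
have [k gE] := sum_payoff_del del.
have [[k' _ fE] _] := tijs_quotientE G'.
have fP := union_own_del del ut.
have BP : B \in unions G' by have /fsetP/(_ B) := ut; rewrite !inE eqxx => /andP[].
pose f (B' : {fset A}) := \sum_(i <- B') payoff T G' i - union_own G' B'.
pose g (B' : {fset A}) :=
  \sum_(i <- B') payoff T G i - union_own G (B' `&` agents G).
suff fg : forall B', B' \in unions G' -> f B' = g B'.
  move=> B' BP'; have := fg _ BP'; rewrite /f /g; have [-> _] := fP _ BP'.
  by rewrite opprD addrCA [RHS]addrC => /addrI/eqP; rewrite subr_eq => /eqP.
apply: (@proportional_eq _ _ _ f g (union_joint G') k' k) => [B' _|B' BP'|B' BP'|].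
- by apply: joint_ge0; exact: cost_ge0.
- rewrite /f; have [_ ->] := coalitional_tijs_unionE BP'.
  by rewrite fE // addrC addKr.
- by rewrite /g gE //; have [_ ->] := fP _ BP'; rewrite addrC addKr.
(* Exclusive costs in [G] are replaced by those in [G'], which exceed them by [cost G' t] in
   total. *)
have -> : \sum_(B' <- unions G') g B' =
    \sum_(B' <- unions G') \sum_(i <- B') payoff T G i
    - \sum_(B' <- unions G') union_own G' B' + cost G' t.
  have := sum_if_pred1 (unions G') B (cost G' t); rewrite BP => <-.
  rewrite -sumrB -big_split /=; apply: eq_big_seq => B' BP'.
  by have [-> _] := fP _ BP'; rewrite opprD addrA subrK.
rewrite /f sumrB !sum_unions tijs_PO (total_cost_del del).
(* Agents lost in the deletion are paid 0 in [G], so (PO) for [G] gives the sum over [agents G']. *)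
rewrite -(payoffI T G (agents G')) (fsetIidPr (agents_del_sub del)) tijs_PO.
by rewrite addrAC.
Qed.

Lemma tijs_CPEU : CPEU T.
Proof.
move=> G G' B t BP del ut; have E := tijs_union_del del ut; split.
  by rewrite E // eqxx.
move=> B'; rewrite !inE => /andP[neq BP']; by rewrite E // (negPf neq) addr0.
Qed.

(** The proportionality argument is repeated inside the union of [j], with [tijs_union_del]
    supplying the equality of sums in place of (PO). *)
Lemma tijs_agent_del G G' i t : i \in agents G' -> deletes_section G G' t ->
  users G' t = [fset i] ->
  {in agents G', forall j,
     payoff T G' j = payoff T G j + (if j == i then cost G' t else 0)}.
Proof.
move=> iN del ut j /union_exists[B BP jB].
have [Bi BiP iBi] := union_exists iN.
have sumE := tijs_union_del del (uusers_users1 BiP iBi ut) BP.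
have oP := agent_own_del del ut.
have [[k' _ fE] _] := coalitional_tijs_unionE BP.
(* The formula extends to members absent from [G], for whom everything vanishes; if the whole union
   disappears, [k = 0] will do. *)
have [k gE] : exists k,
    {in B, forall j, payoff T G j = agent_own G j + k * agent_joint G j}.
  have out l : l \notin agents G -> agent_own G l = 0 /\ agent_joint G l = 0.
    rewrite mem_agents negbK => /eqP u0.
    by rewrite /agent_own /agent_joint own_eq0 // joint_eq0.
  have [BG|/eqP B0] := orP (unions_del del BP).
    have [[k _ kE] _] := coalitional_tijs_unionE BG; exists k => l lB.
    have [lG|lG] := boolP (l \in agents G); first by rewrite kE // inE lB.
    by rewrite payoff_out //; have [-> ->] := out l lG; rewrite mulr0 addr0.
  exists 0 => l lB; have lG : l \notin agents G.
    by apply/negP => lG; have /fsetP/(_ l) := B0; rewrite !inE lB lG.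
  by rewrite payoff_out //; have [-> ->] := out l lG; rewrite mulr0 addr0.
pose f l := payoff T G' l - agent_own G' l.
pose g l := payoff T G l - agent_own G l.
suff fg : forall l, l \in B -> f l = g l.
  have := fg _ jB; rewrite /f /g; have [-> _] := oP j.
  by rewrite opprD addrCA [RHS]addrC => /addrI/eqP; rewrite subr_eq => /eqP.
apply: (@proportional_eq _ _ _ f g (agent_joint G') k' k) => [l _|l lB|l lB|].
- by apply: joint_ge0; exact: cost_ge0.
- by rewrite /f fE // addrC addKr.
- by rewrite /g gE //; have [_ ->] := oP l; rewrite addrC addKr.
have -> : \sum_(l <- B) g l =
    \sum_(l <- B) payoff T G l - \sum_(l <- B) agent_own G' l
    + (if i \in B then cost G' t else 0).
  rewrite -(sum_if_pred1 B i (cost G' t)) -sumrB -big_split /=.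
  by apply: eq_bigr => l _; have [-> _] := oP l; rewrite opprD addrA subrK.
rewrite /f sumrB sumE (_ : (i \in B) = (B == Bi)); first by rewrite addrAC.
by apply/idP/eqP => [iB|-> //]; apply: (unions_inj BP BiP iB).
Qed.

Lemma tijs_CPEA : CPEA T.
Proof.
move=> G G' i t iN del ut; have E := tijs_agent_del iN del ut; split.
  by rewrite E // eqxx.
by move=> j; rewrite !inE => /andP[neq jN]; rewrite E // (negPf neq) addr0.
Qed.

End CoalitionalTijs.

(** * Uniqueness *)

Section Uniqueness.
Variables (R : realType) (A S : choiceType).
Variables s1 s2 : solution R A S.
Hypotheses (PO1 : PO s1) (PO2 : PO s2).

Lemma union_payoff_unique : PSSU s1 -> PSSU s2 -> CPEU s1 -> CPEU s2 ->
  forall (G : problem R A S) B, B \in unions G ->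
  \sum_(i <- B) payoff s1 G i = \sum_(i <- B) payoff s2 G i.
Proof.
move=> PSSU1 PSSU2 CPEU1 CPEU2 G.
have [n] := ubnP #|` sset G|; elim: n G => // n IHn G leGn B BP.
have [E|/fset0Pn[t]] := eqVneq (uexclusive G) fset0.
  have E0 : uexcl_uses G = fset0.
    apply/fsetP => t; rewrite inE; apply/negP => /bigfcupP[B' _].
    by rewrite E fsetI0 inE.
  have [[k1 _ k1E] [k2 _ k2E]] := (PSSU1 G E0, PSSU2 G E0).
  apply: (proportional_eq _ k1E k2E _ BP) => [B' _|].
    by rewrite ushared_costE; apply: joint_ge0; exact: cost_ge0.
  by rewrite !sum_unions PO1 PO2.
rewrite !inE /= => /andP[tG0 /cardfs1P[Bt ut]].
have tG : t \in sset G by rewrite inE.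
have usE B' : (B' \in unions G) && (t \in usedby G B') = (B' == Bt).
  by have /fsetP/(_ B') := ut; rewrite !inE.
have BtP : Bt \in unions G by have := usE Bt; rewrite eqxx => /andP[].
(* The last section cannot be deleted; but then every union uses [t], so [B] is the only one and
   (PO) fixes its total. *)
have [Gt|Gt] := eqVneq (sset G) [fset t].
  have P1 : unions G = [fset B].
    apply/fsetP => B'; rewrite inE; apply/idP/eqP => [BP'|-> //].
    have tB B0 : B0 \in unions G -> t \in usedby G B0.
      move=> BP0; have [i iB] := unions_neq0 BP0.
      have := fsubsetP (unions_sub BP0) _ iB; rewrite mem_agents => /fset0Pn[s si].
      have := fsubsetP (uses_sub G i) _ si; rewrite Gt inE => /eqP st.
      by apply/usedbyP; exists i; rewrite -?st.
    have := usE B'; have := usE B.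
    by rewrite BP BP' !tB //= => /esym/eqP -> /esym/eqP ->.
  have sumB (s : solution R A S) :
      \sum_(i <- B) payoff s G i = \sum_(i <- agents G) payoff s G i.
    by rewrite -sum_unions P1 big_seq_fset1.
  by rewrite !sumB PO1 PO2.
have [G0 del lt] := restr_problem_exists tG Gt.
have IH B' : B' \in unions G ->
    \sum_(i <- B') payoff s1 G0 i = \sum_(i <- B') payoff s2 G0 i.
  move=> BP'; rewrite -(payoffI s1) -(payoffI s2).
  have [BG|/eqP ->] := orP (unions_del del BP'); last by rewrite !big_seq_fset0.
  by apply: IHn BG; apply: leq_trans lt _.
have [E1 F1] := CPEU1 _ _ _ _ BtP del ut.
have [E2 F2] := CPEU2 _ _ _ _ BtP del ut.
have [->|neq] := eqVneq B Bt; first by rewrite E1 E2 IH.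
by rewrite F1 ?F2 ?IH // !inE neq.
Qed.

(** Same induction on the number of sections, now deleting sections exclusive to an agent. *)
Lemma solution_unique : PSSA s1 -> PSSA s2 -> PSSU s1 -> PSSU s2 ->
  CPEA s1 -> CPEA s2 -> CPEU s1 -> CPEU s2 ->
  forall G : problem R A S, s1 G = s2 G.
Proof.
move=> PSSA1 PSSA2 PSSU1 PSSU2 CPEA1 CPEA2 CPEU1 CPEU2 G; apply: solution_eqP.
have [n] := ubnP #|` sset G|; elim: n G => // n IHn G leGn.
have [E|/fset0Pn[t]] := eqVneq (exclusive G) fset0.
  move=> i /union_exists[B BP iB].
  have E0 : excl_uses G B = fset0.
    apply/fsetP => t; rewrite inE; apply/negP => /bigfcupP[j _].
    by rewrite E fsetI0 inE.
  have [[k1 _ k1E] [k2 _ k2E]] := (PSSA1 G B BP E0, PSSA2 G B BP E0).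
  apply: (proportional_eq _ k1E k2E _ iB) => [j _|].
    by rewrite shared_costE; apply: joint_ge0; exact: cost_ge0.
  (* Within [B], the equality of sums comes from the uniqueness of the union totals. *)
  exact: union_payoff_unique.
rewrite !inE /= => /andP[tG0 /cardfs1P[i ut]].
have tG : t \in sset G by rewrite inE.
have usE j : (j \in agents G) && (t \in uses G j) = (j == i).
  by have /fsetP/(_ j) := ut; rewrite !inE.
have iN : i \in agents G by have := usE i; rewrite eqxx => /andP[].
(* With [t] as the only section, every agent uses it, so [i] is alone and (PO) gives the payoff. *)
have [Gt|Gt] := eqVneq (sset G) [fset t].
  have N1 : agents G = [fset i].
    apply/fsetP => j; rewrite inE -usE; apply/esym/andb_idr.
    rewrite mem_agents => /fset0Pn[s sj].
    have := fsubsetP (uses_sub G j) _ sj; rewrite Gt inE => /eqP st.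
    by rewrite -st.
  have sumi (s : solution R A S) : payoff s G i = \sum_(j <- agents G) payoff s G j.
    by rewrite N1 big_seq_fset1.
  by move=> j; rewrite N1 inE => /eqP ->; rewrite !sumi PO1 PO2.
have [G0 del lt] := restr_problem_exists tG Gt.
have IH j : payoff s1 G0 j = payoff s2 G0 j.
  have [jN|jN] := boolP (j \in agents G0); last by rewrite !payoff_out.
  by apply: IHn jN; apply: leq_trans lt _.
have [E1 F1] := CPEA1 _ _ _ _ iN del ut.
have [E2 F2] := CPEA2 _ _ _ _ iN del ut.
move=> j jN; have [->|neq] := eqVneq j i; first by rewrite E1 E2 IH.
by rewrite F1 ?F2 ?IH // !inE neq.
Qed.

End Uniqueness.

Theorem theorem3p2 (R : realType) (A S : choiceType) :
  let T := coalitional_tijs_solution (R := R) (A := A) (S := S) in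
  [/\ PO T, PSSA T, PSSU T, CPEA T & CPEU T] /\
  (forall sigma : solution R A S,
     PO sigma -> PSSA sigma -> PSSU sigma -> CPEA sigma -> CPEU sigma ->
     forall G : problem R A S, sigma G = T G).
Proof.
move=> T; have TP : [/\ PO T, PSSA T, PSSU T, CPEA T & CPEU T].
  split; [exact: tijs_PO|exact: tijs_PSSA|exact: tijs_PSSU|exact: tijs_CPEA|].
  exact: tijs_CPEU.
split=> // sigma *; have [*] := TP; exact: solution_unique.
Qed.
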